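(* Let $n,p\ge 1$, let $0<\mu\le L<\infty$, and let $f_1,\dots,f_n:\mathbb{R}^p\to\mathbb{R}$ be differentiable, $\mu$-strongly convex functions with $L$-Lipschitz continuous gradients. Let $x^*$ be the minimizer of $f=\frac1n\sum_{i=1}^n f_i$, let $\kappa=L/\mu$ and $\rho=(\kappa-1)/(\kappa+1)$. Let $(x^k)_{k\ge 0}$ be the sequence generated by the DIAG method from $x^0\in\mathbb{R}^p$ with stepsize $\epsilon=2/(\mu+L)$. Then for $k=1,\dots,n$, $$\|x^{k}-x^*\|\le \rho\left[1-\frac{(k-1)(1-\rho)}{n}\right]\|x^0-x^*\|,$$ and for all $k>n$, $$\|x^{k}-x^*\|\le \rho^{\lfloor \frac{k-1}{n}\rfloor+1}\left[1-\frac{1-\rho}{n}\times\min\left\{1,\frac{n-1}{2}\right\}\right]\|x^0-x^*\|,$$ where $\lfloor a\rfloor$ denotes the floor of $a$.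
   Context: $\|\cdot\|$ is the Euclidean norm. A differentiable $f_i$ is $\mu$-strongly convex if $(\nabla f_i(x)-\nabla f_i(y))^T(x-y)\ge \mu\|x-y\|^2$ for all $x,y\in\mathbb{R}^p$; its gradient is $L$-Lipschitz if $\|\nabla f_i(x)-\nabla f_i(y)\|\le L\|x-y\|$ for all $x,y\in\mathbb{R}^p$. DIAG (Double Incremental Aggregated Gradient) method with stepsize $\epsilon$: given $x^0\in\mathbb{R}^p$, set $y_1^0=\dots=y_n^0=x^0$. For $k=0,1,2,\dots$, let $i^k=(k \bmod n)+1$, compute $$x^{k+1}=\frac1n\sum_{i=1}^n y_i^k-\frac{\epsilon}{n}\sum_{i=1}^n\nabla f_i(y_i^k),$$ and set $y_{i^k}^{k+1}=x^{k+1}$ and $y_i^{k+1}=y_i^k$ for $i\ne i^k$. *)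

(* Defs.v *)
(* MathComp-Analysis; R is an arbitrary realType and R^p is 'rV[R]_p. *)
From HB Require Import structures.
From mathcomp Require Import all_boot all_order all_algebra.
From mathcomp Require Import boolp classical_sets reals topology normedtype derive.

Set Implicit Arguments.
Unset Strict Implicit.
Unset Printing Implicit Defensive.

Import Order.TTheory GRing.Theory Num.Theory.
Import numFieldNormedType.Exports.
Local Open Scope ring_scope.

Definition dot (R : realType) (p : nat) (u v : 'rV[R]_p) : R :=
  (u *m v^T) 0 0.

(* The library norm on 'rV[R]_p is the sup norm, hence this definition.  The
   two norms are equivalent, so [differentiable] has its usual meaning. *)
Definition enorm (R : realType) (p : nat) (v : 'rV[R]_p) : R :=
  Num.sqrt (dot v v).

Definition grad (R : realType) (p : nat) (f : 'rV[R]_p -> R) (x : 'rV[R]_p) :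
    'rV[R]_p :=
  \row_(j < p) 'D_(delta_mx 0 j) f x.

Lemma diff_grad (R : realType) (p : nat) (f : 'rV[R]_p -> R)
    (x v : 'rV[R]_p) :
  differentiable f x -> 'd f x v = dot (grad f x) v.
Proof.
move=> df; rewrite /dot mxE {1}(row_sum_delta v) linear_sum /=.
by apply: eq_bigr => j _; rewrite linearZ /= !mxE deriveE// mulrC.
Qed.

Definition strongly_convex (R : realType) (p : nat) (mu : R)
    (f : 'rV[R]_p -> R) : Prop :=
  forall x y : 'rV[R]_p,
    mu * enorm (x - y) ^+ 2 <= dot (grad f x - grad f y) (x - y).

Definition lipschitz_grad (R : realType) (p : nat) (L : R)
    (f : 'rV[R]_p -> R) : Prop :=
  forall x y : 'rV[R]_p, enorm (grad f x - grad f y) <= L * enorm (x - y).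

Definition average (R : realType) (n p : nat) (f : 'I_n -> 'rV[R]_p -> R)
    (x : 'rV[R]_p) : R :=
  n%:R^-1 * \sum_(i < n) f i x.

Definition is_minimizer (R : realType) (p : nat) (f : 'rV[R]_p -> R)
    (xs : 'rV[R]_p) : Prop :=
  forall x : 'rV[R]_p, f xs <= f x.

Definition diag_step (R : realType) (n p : nat) (f : 'I_n -> 'rV[R]_p -> R)
    (eps : R) (y : 'I_n -> 'rV[R]_p) : 'rV[R]_p :=
  n%:R^-1 *: \sum_(i < n) y i - (eps / n%:R) *: \sum_(i < n) grad (f i) (y i).

(* Indices are 0-based, so the index (k mod n) + 1 is [k %% n] here. *)
Fixpoint diag_y (R : realType) (n p : nat) (f : 'I_n -> 'rV[R]_p -> R)
    (eps : R) (x0 : 'rV[R]_p) (k : nat) {struct k} : 'I_n -> 'rV[R]_p :=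
  if k is k'.+1 then
    fun i => if val i == (k' %% n)%N then diag_step f eps (diag_y f eps x0 k')
             else diag_y f eps x0 k' i
  else fun=> x0.

Definition diag_x (R : realType) (n p : nat) (f : 'I_n -> 'rV[R]_p -> R)
    (eps : R) (x0 : 'rV[R]_p) (k : nat) : 'rV[R]_p :=
  if k is k'.+1 then diag_step f eps (diag_y f eps x0 k') else x0.

(* Main.v *)
Require Import Defs.
From HB Require Import structures.
From mathcomp Require Import all_boot all_order all_algebra.
From mathcomp Require Import boolp classical_sets reals topology normedtype derive.
From mathcomp Require Import functions ring lra zify.

Import Order.TTheory GRing.Theory Num.Theory.
Import numFieldNormedType.Exports.
Local Open Scope ring_scope.

(** Put [e k = |x k - xs|].  Cocoercivity of the gradient of each [f i] makes the
    map [z |-> z - eps * grad (f i) z], for [eps = 2 / (mu + L)], a contraction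
    of ratio [rho = (L - mu) / (L + mu)].  The gradients [grad (f i) xs] sum to
    zero, so averaging over [i] bounds [e k.+1] by [rho] times the mean of the
    [n] last values of [e], where values before time 0 are read as [e 0].  The
    rates follow from this scalar recursion: after the first cycle all values
    are at most [rho * e 0]; summing the first-cycle bounds gives the bracket,
    and each further cycle gains a factor [rho]. *)

(** * Inner product and Euclidean norm: Cauchy-Schwarz and the triangle inequality *)

Section EuclideanSpace.
Context {R : realType} {p : nat}.
Implicit Types (u v w : 'rV[R]_p) (a : R).

Lemma dotE u v : dot u v = \sum_j u 0 j * v 0 j.
Proof. by rewrite /dot mxE; apply: eq_bigr => j _; rewrite mxE. Qed.

Lemma dotC u v : dot u v = dot v u.
Proof. by rewrite !dotE; apply: eq_bigr => j _; rewrite mulrC. Qed.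

Lemma dotDl u v w : dot (u + v) w = dot u w + dot v w.
Proof. by rewrite /dot mulmxDl mxE. Qed.

Lemma dotZl a u w : dot (a *: u) w = a * dot u w.
Proof. by rewrite /dot -scalemxAl mxE. Qed.

Lemma dotDr u v w : dot w (u + v) = dot w u + dot w v.
Proof. by rewrite dotC dotDl !(dotC w). Qed.

Lemma dotZr a u w : dot w (a *: u) = a * dot w u.
Proof. by rewrite dotC dotZl dotC. Qed.

Lemma dotNl u w : dot (- u) w = - dot u w.
Proof. by rewrite -scaleN1r dotZl mulN1r. Qed.

Lemma dotNr u w : dot w (- u) = - dot w u.
Proof. by rewrite dotC dotNl dotC. Qed.

Lemma dot0l w : dot 0 w = 0.
Proof. by rewrite -(scale0r w) dotZl mul0r. Qed.

Definition dot_linear := (dotDl, dotDr, dotNl, dotNr, dotZl, dotZr).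

Lemma dot_suml (I : finType) (F : I -> 'rV[R]_p) w :
  dot (\sum_i F i) w = \sum_i dot (F i) w.
Proof.
exact: (big_morph (fun u => dot u w) (fun u v => dotDl u v w) (dot0l w)).
Qed.

Lemma dot_ge0 u : 0 <= dot u u.
Proof. by rewrite dotE sumr_ge0 // => j _; rewrite -expr2 sqr_ge0. Qed.

Lemma dot_eq0 u : dot u u = 0 -> u = 0.
Proof.
rewrite dotE => /psumr_eq0P u0; apply/rowP => j; rewrite mxE.
have /eqP : u 0 j * u 0 j = 0 by apply: u0 => // i _; rewrite -expr2 sqr_ge0.
by rewrite mulf_eq0 orbb => /eqP.
Qed.

Lemma sqr_enorm u : enorm u ^+ 2 = dot u u.
Proof. by rewrite sqr_sqrtr ?dot_ge0. Qed.

Lemma enorm_ge0 u : 0 <= enorm u.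
Proof. exact: sqrtr_ge0. Qed.

Lemma enormZ a u : 0 <= a -> enorm (a *: u) = a * enorm u.
Proof.
move=> a0; rewrite /enorm !dot_linear mulrA -expr2 sqrtrM ?sqr_ge0 //.
by rewrite sqrtr_sqr ger0_norm.
Qed.

(** Cauchy-Schwarz: the squared norm of [dot v v *: u - dot u v *: v] is [dot v v] times the Gram
    determinant of [u] and [v]. *)
Lemma dot_le_enorm u v : dot u v <= enorm u * enorm v.
Proof.
have [v0|v_neq0] := eqVneq (dot v v) 0.
  by rewrite (dot_eq0 _ v0) dotC dot0l mulr_ge0 ?enorm_ge0.
have vv0 : 0 < dot v v by rewrite lt_def v_neq0 dot_ge0.
have := dot_ge0 (dot v v *: u - dot u v *: v).
rewrite !dot_linear (dotC v u) => h.
have {}h : 0 <= dot v v * (dot u u * dot v v - dot u v ^+ 2).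
  by apply: le_trans h _; rewrite le_eqVlt; apply/orP; left; apply/eqP; ring.
rewrite pmulr_rge0 // subr_ge0 -!sqr_enorm -exprMn in h.
have [uv0|uv0] := ltP (dot u v) 0.
  by apply: le_trans (ltW uv0) _; rewrite mulr_ge0 ?enorm_ge0.
by move: h; rewrite ler_sqr ?nnegrE ?mulr_ge0 ?enorm_ge0.
Qed.

Lemma enormD u v : enorm (u + v) <= enorm u + enorm v.
Proof.
have nu := enorm_ge0 u; have nv := enorm_ge0 v.
rewrite -ler_sqr ?nnegrE ?addr_ge0 ?enorm_ge0 // sqr_enorm !dot_linear.
rewrite (dotC v) -!sqr_enorm.
have := dot_le_enorm u v; lra.
Qed.

Lemma enorm_sum (I : finType) (F : I -> 'rV[R]_p) :
  enorm (\sum_i F i) <= \sum_i enorm (F i).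
Proof.
elim/big_rec2 : _ => [|i x u _ h]; first by rewrite /enorm dot0l sqrtr0.
by apply: le_trans (enormD _ _) _; rewrite lerD2l.
Qed.

End EuclideanSpace.

(** * Quadratic bounds, cocoercivity and contraction for a single function *)

Section ContractionOfGradientStep.
Context {R : realType} {p : nat} {f : 'rV[R]_p -> R}.
Hypothesis f_diff : forall x, differentiable f x.
Implicit Types x y z v : 'rV[R]_p.

Lemma is_derive_line x v (t : R) :
  is_derive t 1 (fun s : R => f (x + s *: v)) (dot (grad f (x + t *: v)) v).
Proof.
have [dl dlE] : is_diff t (fun s : R => x + s *: v) ( *:%R^~ v).
  have dx := is_diff_cst x t; have dv := is_diff_scalel t v.
  by have := is_diffD dx dv; rewrite add0r.
have dfl : differentiable (f \o (fun s : R => x + s *: v)) t.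
  exact: differentiable_comp.
apply: DeriveDef; first exact/derivable1_diffP.
by rewrite (deriveE _ dfl) diff_comp //= dlE scale1r diff_grad.
Qed.

(* The mean value theorem for [f (x + t v) - t <grad f x, v> - c/2 t^2 |v|^2]. *)
Lemma first_order_remainder (c : R) x v : exists2 t : R, 0 < t &
  f (x + v) - f x - dot (grad f x) v - c / 2 * dot v v =
  dot (grad f (x + t *: v) - grad f x) v - c * t * dot v v.
Proof.
pose a := dot (grad f x) v; pose b := c / 2 * dot v v.
pose g (t : R) := f (x + t *: v) - (a * t + b * t ^+ 2).
pose dg (t : R) := dot (grad f (x + t *: v)) v - (a + b * (2 * t)).
have gP (t : R) : is_derive t 1 g (dg t).
  apply: is_deriveB; first exact: is_derive_line.
  by apply: is_derive_eq; rewrite /GRing.scale /=; ring.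
have [t /[!in_itv]/= /andP[t0 _]] := MVT ltr01 (fun t _ => gP t)
  (derivable_within_continuous (fun t _ => @ex_derive _ _ _ _ _ _ _ (gP t))).
rewrite /g /dg scale0r scale1r addr0 => gE.
exists t => //; rewrite !dot_linear -/a -/b.
by move: gE; rewrite /a /b; lra.
Qed.

(** With [c = L] in the remainder, Cauchy-Schwarz and the Lipschitz bound for the displacement
    [t *: v] make its right-hand side nonpositive. *)
Lemma quadratic_upper_bound {L : R} (x v : 'rV[R]_p) : 0 <= L ->
  lipschitz_grad L f ->
  f (x + v) <= f x + dot (grad f x) v + L / 2 * dot v v.
Proof.
move=> L0 fL; have [t t0] := first_order_remainder L x v.
suff : dot (grad f (x + t *: v) - grad f x) v <= L * t * dot v v by lra.
apply: le_trans (dot_le_enorm _ _) _.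
apply: le_trans (ler_wpM2r (enorm_ge0 v) (fL _ _)) _.
by rewrite (addrC x) addrK (enormZ _ _ (ltW t0)) -sqr_enorm expr2 !mulrA.
Qed.

Lemma quadratic_lower_bound {mu : R} (x v : 'rV[R]_p) : strongly_convex mu f ->
  f x + dot (grad f x) v + mu / 2 * dot v v <= f (x + v).
Proof.
move=> fmu; have [t t0] := first_order_remainder mu x v.
suff : mu * t * dot v v <= dot (grad f (x + t *: v) - grad f x) v by lra.
(* Tested on the displacement [t *: v], strong convexity yields the goal multiplied by [t], and
   [0 < t] lets this factor cancel. *)
have := fmu (x + t *: v) x.
rewrite (addrC x) addrK sqr_enorm dotZl !dotZr => h.
by rewrite -(ler_pM2l t0); apply: le_trans h; lra.
Qed.

Context {mu L : R}.
Hypotheses (mu_gt0 : 0 < mu) (mu_le_L : mu <= L).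
Hypotheses (f_convex : strongly_convex mu f) (f_lipschitz : lipschitz_grad L f).

Let L_ge0 : 0 <= L.
Proof. exact: ltW (lt_le_trans mu_gt0 mu_le_L). Qed.

(* Compare both quadratic bounds at the minimizer over [z] of the gap between
   the upper bound of [f z] at [x] and its lower bound at [y]. *)
Lemma bregman_lower_bound x y (w : 'rV[R]_p) : mu < L ->
  w = grad f x - grad f y - mu *: (x - y) ->
  dot w w / (2 * (L - mu)) <=
  f x - f y - dot (grad f y) (x - y) - mu / 2 * dot (x - y) (x - y).
Proof.
move=> muL wE; pose s := (L - mu)^-1.
have Lmu : L - mu != 0 by rewrite subr_eq0 gt_eqF.
have hu := quadratic_upper_bound x (- (s *: w)) L_ge0 f_lipschitz.
have hl := quadratic_lower_bound y (x - y - s *: w) f_convex.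
have yE : y + (x - y - s *: w) = x - s *: w by rewrite addrA subrKC.
rewrite yE in hl; have {hl hu yE} := le_trans hl hu.
have -> : dot w w / (2 * (L - mu)) =
    s * dot w w - (L - mu) / 2 * (s ^+ 2 * dot w w).
  by rewrite /s; field.
have : dot (grad f x) w - dot (grad f y) w - mu * dot (x - y) w = dot w w.
  by rewrite -dotZl -!dotNl -!dotDl -wE.
rewrite !dot_linear (dotC w x) (dotC w y) => <-; lra.
Qed.

(** Adding the Bregman bounds for [(x, y)] and [(y, x)] cancels the values of [f]; there [w] is
    [g - mu *: d] up to sign, and clearing [L - mu] gives the claim. *)
Lemma grad_cocoercive x y d g : d = x - y -> g = grad f x - grad f y ->
  L * mu * dot d d + dot g g <= (L + mu) * dot g d.
Proof.
move=> dE gE.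
(* The Bregman bound divides by [L - mu]. If [L = mu], both terms on the left are at most
   [mu ^+ 2 * dot d d], which strong convexity bounds by [mu * dot g d]. *)
have [muL|Lmu] := ltP mu L; last first.
  have E : L = mu by apply/le_anti/andP.
  have := f_convex x y; rewrite sqr_enorm -dE -gE => h1.
  have := f_lipschitz x y; rewrite -dE -gE.
  rewrite -ler_sqr ?nnegrE ?mulr_ge0 ?enorm_ge0 //.
  rewrite exprMn !sqr_enorm => h2.
  have := ler_wpM2l (ltW mu_gt0) h1; rewrite E in h2 *; lra.
have := lerD (bregman_lower_bound x y _ muL erefl)
             (bregman_lower_bound y x _ muL erefl).
rewrite /= -[y - x]opprB -[grad f y - grad f x]opprB -dE -gE.
have Lmu : 0 < L - mu by rewrite subr_gt0.
have -> : - g - mu *: - d = - (g - mu *: d) by rewrite scalerN opprD.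
have : dot (grad f x) d - dot (grad f y) d = dot g d by rewrite gE !dot_linear.
rewrite !dot_linear (dotC d g) => gdE.
rewrite -mulrDl ler_pdivrMr ?mulr_gt0 // -gdE; lra.
Qed.

(** This value of [eps] makes the difference of the two squared sides exactly [4 / (mu + L) ^+ 2]
    times the slack in the cocoercivity inequality. *)
Lemma gradient_step_contraction x y :
  enorm (x - y - 2 / (mu + L) *: (grad f x - grad f y)) <=
  (L / mu - 1) / (L / mu + 1) * enorm (x - y).
Proof.
set eps := 2 / (mu + L).
have muL : 0 < mu + L := ltr_wpDr L_ge0 mu_gt0.
have -> : (L / mu - 1) / (L / mu + 1) = (L - mu) / (mu + L).
  by field; rewrite !gt_eqF //; lra.
have rho0 : 0 <= (L - mu) / (mu + L) by rewrite divr_ge0 // ?subr_ge0 // ltW.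
rewrite -ler_sqr ?nnegrE ?enorm_ge0 //; last by rewrite mulr_ge0 ?enorm_ge0.
rewrite exprMn !sqr_enorm.
have := grad_cocoercive x y _ _ erefl erefl.
move: (x - y) (grad f x - grad f y) => d g; rewrite !dot_linear (dotC d g) => h.
rewrite -subr_ge0.
have -> : ((L - mu) / (mu + L)) ^+ 2 * dot d d -
   (dot d d - eps * dot g d + (- (eps * dot g d) - - (eps * (eps * dot g g)))) =
   4 / (mu + L) ^+ 2 * ((L + mu) * dot g d - (L * mu * dot d d + dot g g)).
  by rewrite /eps; field; rewrite gt_eqF.
by rewrite mulr_ge0 ?subr_ge0 // divr_ge0 // sqr_ge0.
Qed.

End ContractionOfGradientStep.

(* At [xs + v] with [v = - (n L)^-1 G], [G] the sum of the gradients, the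
   quadratic upper bounds give [0 <= - |G|^2 / (2 n L)], with no need of a
   Fermat rule for [average f]. *)
Lemma sum_grad_minimizer {R : realType} {n p : nat} {L : R}
    {f : 'I_n -> 'rV[R]_p -> R} {xs : 'rV[R]_p} :
  (0 < n)%N -> 0 < L -> (forall i x, differentiable (f i) x) ->
  (forall i, lipschitz_grad L (f i)) -> is_minimizer (average f) xs ->
  \sum_i grad (f i) xs = 0.
Proof.
move=> n0 L0 f_diff f_lip xs_min; set G := \sum_i _.
have nR : 0 < n%:R :> R by rewrite ltr0n.
pose v := - ((n%:R * L)^-1 *: G).
have := xs_min (xs + v); rewrite /average ler_pM2l ?invr_gt0 // => h.
have {}h : \sum_i f i xs <=
    \sum_i (f i xs + dot (grad (f i) xs) v + L / 2 * dot v v).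
  apply: le_trans h _; apply: ler_sum => i _.
  exact: (quadratic_upper_bound (f_diff i) _ _ (ltW L0) (f_lip i)).
move: h; rewrite !big_split /= -dot_suml -/G sumr_const card_ord -mulr_natr.
rewrite -addrA lerDl /v !dot_linear opprK.
set s := (n%:R * L)^-1; set g := dot G G => h.
have {h} : 0 <= - (s / 2 * g).
  apply: le_trans h _; rewrite le_eqVlt; apply/orP; left; apply/eqP.
  by rewrite /s; field; rewrite !gt_eqF.
rewrite oppr_ge0 pmulr_rle0 ?divr_gt0 ?invr_gt0 ?mulr_gt0 // => g0.
by apply: dot_eq0; apply/le_anti; rewrite g0 dot_ge0.
Qed.

(** * The stored points as the last [n] iterates *)

Section DiagIterates.
Context {R : realType} {n p : nat} (f : 'I_n -> 'rV[R]_p -> R) (eps : R).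
Context (x0 : 'rV[R]_p).
Local Notation x := (diag_x f eps x0).
Local Notation y := (diag_y f eps x0).

(* Truncated subtraction yields [x 0 = x0] for the entries not yet updated. *)
Lemma diag_yE k j (i : 'I_n) : (j < n)%N -> val i = ((k + j) %% n)%N ->
  y k i = x (k.+1 + j - n).
Proof.
elim: k j i => [|k IHk] j i jn iE.
  by have -> : (1 + j - n)%N = 0%N by lia.
rewrite /=; case: ifPn => [/eqP ik|ik].
  (* Refreshed entry: [j.+1] is a positive multiple of [n] and at most [n], so [j = n - 1] and the
     stored point is [x k.+1]. *)
  have /eqP : (k + j.+1 = k + 0 %[mod n])%N.
    by rewrite addn0 addnS -addSn; apply: etrans (esym iE) ik.
  rewrite eqn_modDl mod0n => /dvdnP[q jE].
  have {q}jE : j.+1 = n by case: q jE => [|[|q]] jE; nia.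
  by have -> : (k.+2 + j - n)%N = k.+1 by lia.
(* An untouched entry has offset [j.+1] relative to time [k]; this is not [n], since offset [n]
   designates the refreshed index. *)
have jn' : (j.+1 < n)%N.
  rewrite ltn_neqAle jn andbT; apply: contra ik => /eqP jE.
  by rewrite iE addSnnS jE modnDr.
by rewrite (IHk j.+1) ?addSnnS // iE addSnnS.
Qed.

(** The shift [j |-> (k + j) %% n] permutes the indices, so a sum does not see the cyclic order of
    storage. *)
Lemma sum_diag_y (F : 'rV[R]_p -> R) k : (0 < n)%N ->
  \sum_i F (y k i) = \sum_(j < n) F (x (k.+1 + j - n)).
Proof.
move=> n0; pose h (j : 'I_n) := Ordinal (ltn_pmod (k + j) n0).
have h_inj : injective h.
  move=> i j /(congr1 val)/eqP; rewrite /= eqn_modDl !modn_small // => /eqP.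
  exact: val_inj.
by rewrite (reindex_inj h_inj); apply: eq_bigr => j _; rewrite (diag_yE k j).
Qed.

End DiagIterates.

(** * Decay rates from the scalar window recursion *)

Section WindowRecursion.
Context {R : realType} {n : nat} {rho : R} {e : nat -> R}.
Hypotheses (n_gt0 : (0 < n)%N) (rho_ge0 : 0 <= rho) (rho_lt1 : rho < 1).
Hypothesis e0_ge0 : 0 <= e 0%N.
Hypothesis e_rec : forall k,
  e k.+1 <= rho / n%:R * \sum_(0 <= j < n) e (k.+1 + j - n)%N.

Let nR : 0 < n%:R :> R. Proof. by rewrite ltr0n. Qed.

Let avg_le k (B : R) : \sum_(0 <= j < n) e (k.+1 + j - n)%N <= n%:R * B ->
  e k.+1 <= rho * B.
Proof.
move=> h; apply: le_trans (e_rec k) _.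
apply: le_trans (ler_wpM2l _ h) _; first by rewrite divr_ge0 // ltW.
by rewrite mulrA divfK ?gt_eqF.
Qed.

Let window_le k (B : R) :
  (forall j, (j < n)%N -> e (k.+1 + j - n)%N <= B) -> e k.+1 <= rho * B.
Proof.
move=> h; apply: avg_le; rewrite mulr_natl -[X in _ *+ X]subn0 -sumr_const_nat.
by apply: ler_sum_nat => j /andP[_ /h].
Qed.

Let e_le_e0 k : e k <= e 0%N.
Proof.
elim/ltn_ind: k => -[//|k] IHk.
apply: le_trans (window_le k (e 0%N) _) _ => [j jn|]; first by apply: IHk; lia.
by rewrite ler_piMl // ltW.
Qed.

Let e_le_rho k : e k.+1 <= rho * e 0%N.
Proof. by apply: window_le => j _; apply: e_le_e0. Qed.

(** The window holds [k] values from times 1 to [k], each at most [rho * e 0], and [n - k] values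
    bounded by [e 0]. *)
Lemma window_first_cycle k : (k < n)%N ->
  e k.+1 <= rho * ((1 - k%:R * (1 - rho) / n%:R) * e 0%N).
Proof.
move=> kn; apply: avg_le.
rewrite (@big_cat_nat _ _ _ (n - k)) ?leq_subr //=.
have h1 : \sum_(0 <= j < n - k) e (k.+1 + j - n)%N <= (n - k)%:R * e 0%N.
  rewrite mulr_natl -[X in _ *+ X]subn0 -sumr_const_nat.
  by apply: ler_sum_nat.
have h2 : \sum_(n - k <= j < n) e (k.+1 + j - n)%N <= k%:R * (rho * e 0%N).
  rewrite mulr_natl -[X in _ *+ X](subKn (ltnW kn)) -sumr_const_nat.
  apply: ler_sum_nat => j /andP[jk jn].
  by have -> : (k.+1 + j - n)%N = (k + j - n).+1 by lia.
apply: le_trans (lerD h1 h2) _; rewrite natrB ?(ltnW kn) //.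
rewrite le_eqVlt; apply/orP; left; apply/eqP; field.
by rewrite gt_eqF.
Qed.

Let C := 1 - (1 - rho) / n%:R * Num.min 1 ((n%:R - 1) / 2) : R.

Let C_ge0 : 0 <= C.
Proof.
have n1 : 1 <= n%:R :> R by rewrite ler1n.
rewrite subr_ge0 mulrAC ler_pdivrMr // mul1r; apply: le_trans n1.
have rho1 : 0 <= 1 - rho by rewrite subr_ge0 ltW.
apply: le_trans (ler_wpM2l rho1 (_ : _ <= 1)) _; first by rewrite ge_min lexx.
by rewrite mulr1 gerBl.
Qed.

Let sum_natD (r m : nat) :
  \sum_(0 <= j < m) (r + j)%:R = m%:R * (2 * r%:R + m%:R - 1) / 2 :> R.
Proof.
elim: m => [|m IHm]; first by rewrite big_geq // !mul0r.
by rewrite big_nat_recr //= IHm natrD -(natr1 m); field.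
Qed.

(* The indices of any final segment of [0, n - 1] average to at least
   [(n - 1) / 2], so the first-cycle values still in the window have mean at
   most [rho * C * e 0]. *)
Let window_second_cycle r : (r < n)%N ->
  e (n + r).+1 <= rho * (rho * (C * e 0%N)).
Proof.
elim/ltn_ind: r => r IHr rn; apply: avg_le.
rewrite (@big_cat_nat _ _ _ (n - r)) ?leq_subr //=.
have h1 : \sum_(0 <= j < n - r) e ((n + r).+1 + j - n)%N <=
    (n - r)%:R * (rho * (C * e 0%N)).
  have h : \sum_(0 <= j < n - r) e ((n + r).+1 + j - n)%N <=
      \sum_(0 <= j < n - r)
        (rho * e 0%N * (1 - (r + j)%:R * ((1 - rho) / n%:R))).
    apply: ler_sum_nat => j /andP[_ jr].
    have -> : ((n + r).+1 + j - n)%N = (r + j).+1 by lia.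
    apply: le_trans (window_first_cycle (r + j) _) _; first by lia.
    by rewrite le_eqVlt; apply/orP; left; apply/eqP; ring.
  apply: le_trans h _; rewrite -mulr_sumr sumrB sumr_const_nat subn0 -mulr_suml.
  rewrite sum_natD natrB ?(ltnW rn) //.
  have nr0 : 0 <= n%:R - r%:R :> R by rewrite subr_ge0 ler_nat ltnW.
  have t0 : 0 <= (1 - rho) / n%:R by rewrite divr_ge0 ?ler0n ?subr_ge0 ?ltW.
  have cP : Num.min 1 ((n%:R - 1) / 2) <= (n%:R - 1) / 2 :> R.
    by rewrite ge_min lexx orbT.
  have r0 : 0 <= r%:R :> R by [].
  rewrite /C; move: (Num.min _ _) ((1 - rho) / n%:R) cP t0 => c t cP t0.
  (* The indices [r, ..., n - 1] have mean [(r + n - 1) / 2], at least [(n - 1) / 2] and hence at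
     least [c]: the gap is a product of nonnegative factors. *)
  rewrite -subr_ge0.
  have -> : (n%:R - r%:R) * (rho * ((1 - t * c) * e 0%N)) -
      rho * e 0%N * (n%:R - r%:R -
        (n%:R - r%:R) * (2 * r%:R + (n%:R - r%:R) - 1) / 2 * t) =
      rho * e 0%N * (n%:R - r%:R) * t * ((r%:R + n%:R - 1) / 2 - c) :> R.
    by field.
  by rewrite !mulr_ge0 //; lra.
(* Times [n + 1] to [n + r] fall under the induction hypothesis, whose extra factor [rho] is dropped
   to match [h1]. *)
have h2 : \sum_(n - r <= j < n) e ((n + r).+1 + j - n)%N <=
    r%:R * (rho * (C * e 0%N)).
  rewrite mulr_natl -[X in _ *+ X](subKn (ltnW rn)) -sumr_const_nat.
  apply: ler_sum_nat => j /andP[jr jn].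
  have -> : ((n + r).+1 + j - n)%N = (n + (r + j - n)).+1 by lia.
  apply: le_trans (IHr (r + j - n)%N _ _) _; try lia.
  by rewrite ler_piMl ?mulr_ge0 // ltW.
apply: le_trans (lerD h1 h2) _.
by rewrite -mulrDl -natrD subnK // ltnW.
Qed.

(** The second cycle starts the induction. Beyond it, every time in the window is at most one cycle
    back, so its exponent is at least [k %/ n], and the recursion adds one more factor [rho]. *)
Lemma window_later_cycles k : (n <= k)%N ->
  e k.+1 <= rho ^+ (k %/ n).+1 * (C * e 0%N).
Proof.
elim/ltn_ind: k => k IHk nk.
have [k2n|k2n] := ltnP k (n + n).
  have -> : (k %/ n)%N = 1%N.
    by rewrite -[k](subnK nk) divnDr // divnn n_gt0 divn_small // ltn_subLR.
  have := window_second_cycle (k - n); rewrite subnKC // expr2 -mulrA; apply.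
  by rewrite ltn_subLR.
rewrite exprS -mulrA; apply: window_le => j jn.
have -> : (k.+1 + j - n)%N = (k - n + j).+1 by lia.
apply: le_trans (IHk (k - n + j)%N _ _) _; try lia.
rewrite ler_wpM2r ?mulr_ge0 // ler_wiXn2l // ?(ltW rho_lt1) //.
have -> : (k %/ n = ((k - n) %/ n).+1)%N.
  by rewrite -{1}[k](subnK nk) divnDr // divnn n_gt0 addn1.
by rewrite ltnS leq_div2r // leq_addr.
Qed.

End WindowRecursion.

(** * Reduction of DIAG to the scalar recursion, and the two rates *)

Theorem proposition2 (R : realType) (n p : nat) (n_gt0 : (0 < n)%N)
    (p_gt0 : (0 < p)%N) (mu L : R) (mu_gt0 : 0 < mu) (mu_le_L : mu <= L)
    (f : 'I_n -> 'rV[R]_p -> R)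
    (f_diff : forall (i : 'I_n) (x : 'rV[R]_p), differentiable (f i) x)
    (f_convex : forall i : 'I_n, strongly_convex mu (f i))
    (f_lipschitz : forall i : 'I_n, lipschitz_grad L (f i))
    (xs : 'rV[R]_p) (xs_min : is_minimizer (average f) xs)
    (x0 : 'rV[R]_p) :
  let kappa := L / mu in
  let rho := (kappa - 1) / (kappa + 1) in
  let x := diag_x f (2 / (mu + L)) x0 in
  (forall k : nat, (1 <= k <= n)%N ->
     enorm (x k - xs) <=
       rho * (1 - (k%:R - 1) * (1 - rho) / n%:R) * enorm (x0 - xs)) /\
  (forall k : nat, (n < k)%N ->
     enorm (x k - xs) <=
       rho ^+ ((k - 1) %/ n + 1)%N *
       (1 - (1 - rho) / n%:R * Num.min 1 ((n%:R - 1) / 2)) *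
       enorm (x0 - xs)).
Proof.
move=> kappa rho x.
have kappa_ge1 : 1 <= kappa by rewrite ler_pdivlMr // mul1r.
have kappa1 : 0 < kappa + 1 by lra.
have rho_ge0 : 0 <= rho by rewrite divr_ge0 ?subr_ge0 // ltW.
have rho_lt1 : rho < 1 by rewrite ltr_pdivrMr // mul1r; lra.
have nR : 0 < n%:R :> R by rewrite ltr0n.
have L_gt0 := lt_le_trans mu_gt0 mu_le_L.
have G0 := sum_grad_minimizer n_gt0 L_gt0 f_diff f_lipschitz xs_min.
pose e k := enorm (x k - xs).
have e_rec k : e k.+1 <= rho / n%:R * \sum_(0 <= j < n) e (k.+1 + j - n)%N.
  set eps := 2 / (mu + L) in x e *; pose y := diag_y f eps x0 k.
  (* By [G0] the gradients at [xs] can be inserted at no cost, so the error is a mean of differences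
     between gradient steps from [y i] and from [xs]. *)
  have -> : e k.+1 = enorm (n%:R^-1 *:
      \sum_i (y i - xs - eps *: (grad (f i) (y i) - grad (f i) xs))).
    congr enorm; rewrite big_split /= sumrB sumr_const card_ord.
    rewrite sumrN -scaler_sumr sumrB G0 subr0 -(scaler_nat n xs).
    rewrite scalerBr scalerBr !scalerA mulVf ?gt_eqF // scale1r.
    by rewrite /x /= /diag_step -/y addrAC (mulrC n%:R^-1).
  rewrite enormZ ?invr_ge0 ?ler0n // (mulrC rho) -mulrA.
  rewrite ler_wpM2l ?invr_ge0 ?ler0n //.
  rewrite big_mkord -(sum_diag_y f eps x0 (fun z => enorm (z - xs))) // mulr_sumr.
  apply: le_trans (enorm_sum _ _) _; apply: ler_sum => i _.
  exact: gradient_step_contraction.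
split=> [[//|k] /andP[_ kn]|[//|k] kn].
  rewrite -mulrA -natr1 addrK.
  exact: (window_first_cycle n_gt0 rho_ge0 rho_lt1 (enorm_ge0 _) e_rec).
rewrite subn1 addn1 -mulrA.
exact: (window_later_cycles n_gt0 rho_ge0 rho_lt1 (enorm_ge0 _) e_rec).
Qed.
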